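(* Let $m\ge 1$ and let $\pi_k$, $k=0,1,2,\ldots$, be $m\times m$ matrices over $\overline{K}_c$ such that $|\pi_k|\le\gamma$ for all $k$, with some constant $\gamma>0$, and $|\pi_0|<1$. Let $g$ be a continuous $\mathbf F_q$-linear function on $O$ with values in the $m\times m$ matrices over $\overline{K}_c$ that solves $\tau dg=\pi_0g$, i.e. $g(xt)-xg(t)=\pi_0g(t)$ for $t\in O$. Let $\lambda_1,\ldots,\lambda_m\in\overline{K}_c$ be the eigenvalues of $\pi_0$. If $$\lambda_i-\lambda_j^{q^k}\ne[k],\qquad i,j=1,\ldots,m;\ k=1,2,\ldots,$$ then the system $$\tau du-P(\tau)u=0,\qquad P(\tau)u=\sum_{k=0}^\infty\pi_k\tau^k(u),$$ has a matrix solution (for $t\in O$ with $|t|$ sufficiently small) of the form $$u(t)=W(g(t)),\qquad W(s)=\sum_{k=0}^\infty w_k\,s^{q^k},\qquad w_0=I_m,$$ where the $w_k$ are $m\times m$ matrices over $\overline{K}_c$, and the series for $W$ has a positive radius of convergence.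
   Context: Let $q$ be a power of a prime $p$, and let $K=\mathbf F_q((x))$ with absolute value $|t|=q^{-N}$ for $t=\sum_{j\ge N}\xi_jx^j$, $\xi_N\ne 0$, and $|0|=0$. Let $O=\{t\in K:|t|\le 1\}$, and let $\overline{K}_c$ be the completion of an algebraic closure of $K$ with the uniquely extended absolute value. For an integer $k\ge 0$ put $[k]=x^{q^k}-x$. For a matrix $\pi=(\pi_{ij})$ over $\overline{K}_c$ put $|\pi|=\max_{i,j}|\pi_{ij}|$. The operator $\tau$ is the $q$-Frobenius, acting entrywise: $\tau^k(\pi)=(\pi_{ij}^{q^k})$; for a matrix argument $s$, the notation $s^{q^k}$ means the entrywise power $\tau^k(s)$ (not the matrix power), and $w_ks^{q^k}$ is the matrix product of $w_k$ and $\tau^k(s)$. The Carlitz derivative is $d=\sqrt[q]{\ }\circ\Delta$, where $(\Delta u)(t)=u(xt)-xu(t)$ (the $q$-th root taken entrywise), so that $\tau d=\Delta$. The matrix $I_m$ is the unit matrix. ''Positive radius of convergence'' means that there is $r>0$ such that the series $W(s)$ converges for all matrices $s$ with $|s|<r$. *)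

(* Defs.v *)
From HB Require Import structures.
From mathcomp Require Import all_boot all_order all_algebra.
From mathcomp Require Import zify.
From mathcomp Require Import all_classical all_reals all_analysis.
Set Implicit Arguments.
Unset Strict Implicit.
Unset Printing Implicit Defensive.
Import Order.TTheory GRing.Theory Num.Theory.
Import numFieldNormedType.Exports.
Local Open Scope classical_set_scope.
Local Open Scope ring_scope.

(* Formal Laurent series over F, the coefficient of x^j being lcoef j. *)
Record laurent (F : fieldType) := Laurent {
  lcoef : int -> F;
  lcoefP : exists N : int, forall j : int, j < N -> lcoef j = 0 }.

Section LaurentField.
Variable F : fieldType.
Implicit Types f g h : laurent F.

HB.instance Definition _ := gen_eqMixin (laurent F).
HB.instance Definition _ := gen_choiceMixin (laurent F).

Lemma laurent_ext f g : lcoef f =1 lcoef g -> f = g.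
Proof.
case: f g => [a aP] [b bP] /= /funext ab; case: b / ab bP => bP.
by congr Laurent; exact: Prop_irrelevance.
Qed.

Lemma laurent0_subproof : exists N : int, forall j, j < N -> (0 : F) = 0.
Proof. by exists 0. Qed.
Definition laurent0 := Laurent laurent0_subproof.

Lemma laurentN_subproof f : exists N : int, forall j, j < N -> - lcoef f j = 0.
Proof. by have [N fN] := lcoefP f; exists N => j /fN ->; rewrite oppr0. Qed.
Definition laurentN f := Laurent (laurentN_subproof f).

Lemma laurentD_subproof f g :
  exists N : int, forall j, j < N -> lcoef f j + lcoef g j = 0.
Proof.
have [M fM] := lcoefP f; have [N gN] := lcoefP g.
by exists (Num.min M N) => j; rewrite lt_min => /andP[/fM -> /gN ->]; rewrite addr0.
Qed.
Definition laurentD f g := Laurent (laurentD_subproof f g).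

Lemma laurentDA : associative laurentD.
Proof. by move=> f g h; apply: laurent_ext => n /=; rewrite addrA. Qed.
Lemma laurentDC : commutative laurentD.
Proof. by move=> f g; apply: laurent_ext => n /=; rewrite addrC. Qed.
Lemma laurent0D : left_id laurent0 laurentD.
Proof. by move=> f; apply: laurent_ext => n /=; rewrite add0r. Qed.
Lemma laurentND : left_inverse laurent0 laurentN laurentD.
Proof. by move=> f; apply: laurent_ext => n /=; rewrite addNr. Qed.
HB.instance Definition _ :=
  GRing.isZmodule.Build (laurent F) laurentDA laurentDC laurent0D laurentND.

Definition zero_below f (a : int) := forall j : int, j < a -> lcoef f j = 0.

(* The summand has finite support, and \sum_(i \in [set: int]) sums over it. *)
Definition lconv f g (n : int) : F :=
  \sum_(i \in [set: int]) lcoef f i * lcoef g (n - i).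

Lemma lconv_below f g a b n :
  zero_below f a -> zero_below g b -> n < a + b -> lconv f g n = 0.
Proof.
move=> fa gb nab; rewrite /lconv fsbig1// => i _.
have [/fa ->|ai] := ltP i a; first by rewrite mul0r.
by rewrite gb ?mulr0//; lia.
Qed.

Definition ltrunc (a : int) f (n : nat) : {poly F} :=
  \poly_(k < n) lcoef f (a + k%:Z).

Lemma lconvE f g a b (n k : nat) :
  zero_below f a -> zero_below g b -> (k < n)%N ->
  lconv f g (a + b + k%:Z) = (ltrunc a f n * ltrunc b g n)`_k.
Proof.
move=> fa gb kn; set w := fun j : nat => a + j%:Z.
have w_uniq : uniq (map w (iota 0 k.+1)).
  by rewrite map_inj_uniq ?iota_uniq// => i j /addrI; case.
rewrite /lconv (fsbigE (map w (iota 0 k.+1)))//.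
  rewrite (eq_bigl xpredT) => [|i]; last by rewrite in_setT.
  rewrite big_map (_ : iota 0 k.+1 = index_iota 0 k.+1)// big_mkord coefM.
  apply: eq_bigr => j _; have jk := ltn_ord j.
  rewrite !coef_poly !ifT; [|lia|lia].
  by congr (_ * lcoef g _); rewrite /w; lia.
move=> i _ iN; apply/eqP; rewrite mulf_eq0; apply: contraNT iN.
rewrite negb_or => /andP[/eqP fi /eqP gi].
have ai : a <= i by rewrite leNgt; apply/negP => /fa.
have ik : i <= a + k%:Z.
  by rewrite leNgt; apply/negP => ki; apply: gi; apply: gb; lia.
by apply/mapP; exists (absz (i - a)); [rewrite mem_iota|]; rewrite /w; lia.
Qed.

Lemma laurentM_subproof f g : exists N : int, forall j, j < N -> lconv f g j = 0.
Proof.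
have [a fa] := lcoefP f; have [b gb] := lcoefP g.
by exists (a + b) => j; apply: lconv_below.
Qed.
Definition laurentM f g := Laurent (laurentM_subproof f g).

Lemma laurentC_subproof (c : F) :
  exists N : int, forall j, j < N -> (if j == 0 then c else 0) = 0.
Proof. by exists 0 => j; rewrite lt_def eq_sym => /andP[/negPf->]. Qed.
Definition laurentC (c : F) := Laurent (laurentC_subproof c).

Lemma zero_belowM f g a b :
  zero_below f a -> zero_below g b -> zero_below (laurentM f g) (a + b).
Proof. by move=> fa gb j; apply: lconv_below. Qed.

Lemma zero_belowC c : zero_below (laurentC c) 0.
Proof. by move=> j /=; rewrite lt_def eq_sym => /andP[/negPf->]. Qed.

Lemma zero_below_le f (a b : int) : b <= a -> zero_below f a -> zero_below f b.
Proof. by move=> ba fa j jb; apply: fa; lia. Qed.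

Lemma laurent_ext_from f g a : zero_below f a -> zero_below g a ->
  (forall k : nat, lcoef f (a + k%:Z) = lcoef g (a + k%:Z)) -> f = g.
Proof.
move=> fa ga fg; apply: laurent_ext => n; have [na|an] := ltP n a.
  by rewrite fa ?ga.
by rewrite (_ : n = a + (absz (n - a))%:Z) ?fg//; lia.
Qed.

Lemma coef_ltrunc a f n k : (k < n)%N -> (ltrunc a f n)`_k = lcoef f (a + k%:Z).
Proof. by rewrite coef_poly => ->. Qed.

Lemma coefM_congr (p p' r : {poly F}) k :
  (forall i, (i <= k)%N -> p`_i = p'`_i) -> (p * r)`_k = (p' * r)`_k.
Proof.
by move=> pp'; rewrite !coefM; apply: eq_bigr => i _; rewrite pp'// -ltnS.
Qed.

Lemma laurentMC : commutative laurentM.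
Proof.
move=> f g; have [a fa] := lcoefP f; have [b gb] := lcoefP g.
apply: (@laurent_ext_from _ _ (a + b)); [exact: zero_belowM| |].
  by rewrite addrC; exact: zero_belowM.
move=> k /=; rewrite (lconvE fa gb (ltnSn k)) (addrC a b) (lconvE gb fa (ltnSn k)).
by rewrite mulrC.
Qed.

Lemma laurentMA : associative laurentM.
Proof.
move=> f g h; have [a fa] := lcoefP f; have [b gb] := lcoefP g.
have [c hc] := lcoefP h.
have fgab := zero_belowM fa gb; have ghbc := zero_belowM gb hc.
apply: (@laurent_ext_from _ _ (a + b + c)).
- by rewrite -addrA; exact: zero_belowM.
- exact: zero_belowM.
move=> k /=; rewrite (lconvE fgab hc (ltnSn k)) -(addrA a b c) (lconvE fa ghbc (ltnSn k)).
rewrite [ltrunc a f _ * _]mulrC.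
rewrite (@coefM_congr (ltrunc (b + c) _ _) (ltrunc b g k.+1 * ltrunc c h k.+1)) => [|i ik].
  rewrite (@coefM_congr (ltrunc (a + b) _ _) (ltrunc a f k.+1 * ltrunc b g k.+1)) => [|i ik].
    by congr (nth _ (polyseq _) _); rewrite mulrC mulrA.
  by rewrite coef_ltrunc// -(lconvE fa gb).
by rewrite coef_ltrunc// -(lconvE gb hc).
Qed.

Lemma ltruncC c n : (0 < n)%N -> ltrunc 0 (laurentC c) n = c%:P.
Proof.
move=> n0; apply/polyP => i; rewrite coef_poly coefC add0r /=.
by case: i => [|i]; rewrite ?n0//=; case: ifP.
Qed.

Lemma laurentCM c f n : lcoef (laurentM (laurentC c) f) n = c * lcoef f n.
Proof.
have [a fa] := lcoefP f; have [na|an] := ltP n a.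
  by rewrite (fa n na) mulr0; apply: (zero_belowM (@zero_belowC c) fa); rewrite add0r.
rewrite (_ : n = 0 + a + (absz (n - a))%:Z)/=; last lia.
rewrite (lconvE (@zero_belowC c) fa (ltnSn _)) ltruncC// coefCM coef_ltrunc//.
by rewrite add0r.
Qed.

Lemma laurent1M : left_id (laurentC 1) laurentM.
Proof. by move=> f; apply: laurent_ext => n; rewrite laurentCM mul1r. Qed.

Lemma laurentMDl : left_distributive laurentM (@GRing.add (laurent F)).
Proof.
move=> f g h; have [a0 fa0] := lcoefP f; have [b0 gb0] := lcoefP g.
have [c hc] := lcoefP h; pose a := Num.min a0 b0.
have fa : zero_below f a by apply: zero_below_le fa0; rewrite ge_min lexx.
have ga : zero_below g a by apply: zero_below_le gb0; rewrite ge_min lexx orbT.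
have fga : zero_below (f + g) a by move=> j ja /=; rewrite fa ?ga// addr0.
apply: (@laurent_ext_from _ _ (a + c)); first exact: zero_belowM.
  by move=> j jac /=; rewrite !(lconv_below _ hc jac)// addr0.
move=> k /=; rewrite !(lconvE _ hc (ltnSn k))// -coefD -mulrDl.
congr (nth _ (polyseq (_ * _)) _); apply/polyP => i; rewrite coefD !coef_poly.
by case: ifP => //; rewrite addr0.
Qed.

Lemma laurent1_neq0 : laurentC 1 != 0.
Proof.
by apply/eqP => /(congr1 (@lcoef F ^~ 0)) /= /eqP; rewrite oner_eq0.
Qed.

HB.instance Definition _ := GRing.Zmodule_isComNzRing.Build (laurent F)
  laurentMA laurentMC laurent1M laurentMDl laurent1_neq0.

Definition is_lorder f (N : int) := lcoef f N != 0 /\ zero_below f N.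

Lemma lorder_exists f : f != 0 -> exists N, is_lorder f N.
Proof.
move=> f0; have [a fa] := lcoefP f.
have exk : exists k : nat, lcoef f (a + k%:Z) != 0.
  apply: contrapT => /forallNP nk; move/eqP: f0; apply.
  apply: (laurent_ext_from fa) => // k.
  by apply/eqP; apply: contrapT => /negP; exact: nk.
exists (a + (ex_minn exk)%:Z); case: ex_minnP => k fk kmin; split => // j jk.
have [/fa//|aj] := ltP j a.
apply/eqP; apply: contraT => fj.
have := kmin (absz (j - a)); rewrite (_ : a + _ = j); last lia.
by move=> /(_ fj); lia.
Qed.

(* The first n coefficients of the inverse of the power series with
   coefficients a. *)
Fixpoint inv_coefs (a : nat -> F) (n : nat) : seq F :=
  if n is n'.+1 then
    let s := inv_coefs a n' in
    rcons s ((a 0)^-1 * ((n' == 0)%:R - \sum_(i < n') s`_i * a (n' - i)%N))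
  else [::].

Lemma size_inv_coefs a n : size (inv_coefs a n) = n.
Proof. by elim: n => //= n IH; rewrite size_rcons IH. Qed.

Lemma nth_inv_coefs a n i : (i < n)%N -> (inv_coefs a n)`_i = (inv_coefs a i.+1)`_i.
Proof.
elim: n => // n IH; rewrite ltnS leq_eqVlt => /orP[/eqP->//|i_n].
by rewrite -(IH i_n) [in LHS]/= nth_rcons size_inv_coefs i_n.
Qed.

Lemma inv_coefsP a n : a 0 != 0 ->
  \sum_(i < n.+1) (inv_coefs a i.+1)`_i * a (n - i)%N = (n == 0)%:R.
Proof.
move=> a0; rewrite big_ord_recr /= subnn nth_rcons size_inv_coefs ltnn eqxx.
rewrite mulrC mulVKf// [X in X + _](_ : _ = \sum_(i < n) (inv_coefs a n)`_i * a (n - i)%N).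
  by rewrite addrC subrK.
by apply: eq_bigr => i _; rewrite (nth_inv_coefs a (ltn_ord i)).
Qed.

Lemma laurent_inv_exists f : f != 0 -> exists g, g * f = 1.
Proof.
move=> /lorder_exists[N [fN fbN]].
pose a (k : nat) := lcoef f (N + k%:Z).
have a0 : a 0 != 0 by rewrite /a addr0.
pose c (j : int) := if j < - N then 0 else
  (inv_coefs a (absz (j + N)).+1)`_(absz (j + N)).
have cP : exists M : int, forall j, j < M -> c j = 0.
  by exists (- N) => j jN; rewrite /c jN.
have gN : zero_below (Laurent cP) (- N) by move=> j jN; rewrite /= /c jN.
exists (Laurent cP); apply: (@laurent_ext_from _ _ 0).
- by rewrite -(addNr N); exact: zero_belowM.
- exact: zero_belowC.
move=> k; rewrite [LHS]/= -(addNr N) (lconvE gN fbN (ltnSn k)) addNr add0r.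
rewrite [RHS]/= coefM (_ : (if _ then _ else _) = (k == 0)%:R :> F); last first.
  by case: k.
rewrite -(inv_coefsP k a0); apply: eq_bigr => i _; have ik := ltn_ord i.
rewrite !coef_ltrunc; [|lia|lia]; congr (_ * _).
rewrite /= /c ifF; last lia.
by rewrite (_ : absz _ = i)//; lia.
Qed.

Definition laurentV f := if f == 0 then 0 else xget 0 [set g | g * f = 1].

Lemma laurentMV f : f != 0 -> laurentV f * f = 1.
Proof.
move=> f0; rewrite /laurentV (negPf f0).
exact: (@xgetPex _ 0 [set g | g * f = 1] (laurent_inv_exists f0)).
Qed.

Lemma laurentV0 : laurentV 0 = 0.
Proof. by rewrite /laurentV eqxx. Qed.

HB.instance Definition _ :=
  GRing.ComNzRing_isField.Build (laurent F) laurentMV laurentV0.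

Lemma laurentX_subproof :
  exists N : int, forall j : int, j < N -> (j == 1)%:R = 0 :> F.
Proof.
by exists 1 => j; rewrite lt_def eq_sym => /andP[/negPf->].
Qed.
Definition laurentX := Laurent laurentX_subproof.

End LaurentField.

(* |t| = q^(-N) with N the order of t and q the cardinal of F. *)
Definition laurent_abs (R : realType) (F : finFieldType) (t : laurent F) : R :=
  if t == 0 then 0 else #|F|%:R ^ (- xget 0 [set N | is_lorder t N]).

Lemma laurent_absE (R : realType) (F : finFieldType) (t : laurent F) (N : int) :
  is_lorder t N -> laurent_abs R t = #|F|%:R ^ (- N).
Proof.
move=> tN; rewrite /laurent_abs ifF; last first.
  by apply/negP => /eqP t0; have [] := tN; rewrite t0 eqxx.
congr (_ ^ (- _)); apply: xget_unique => // M [tM tbM].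
have [tN0 tbN] := tN; apply/eqP; rewrite eq_le !leNgt.
apply/andP; split; apply/negP; first by move=> /tbM; apply/eqP.
by move=> /tbN; apply/eqP.
Qed.

Record is_absval (R : realType) (L : fieldType) (v : L -> R) : Prop := {
  absval_ge0 : forall a, 0 <= v a;
  absval_eq0 : forall a, v a = 0 <-> a = 0;
  absvalM : forall a b, v (a * b) = v a * v b;
  absvalD : forall a b, v (a + b) <= Num.max (v a) (v b) }.

Definition is_alg_closure (K : fieldType) (L : closedFieldType)
    (j : {rmorphism K -> L}) : Prop :=
  forall a : L, algebraicOver j a.

Record is_completion (R : realType) (L C : fieldType) (vL : L -> R) (vC : C -> R)
    (i : {rmorphism L -> C}) : Prop := {
  completion_absval : is_absval vC;
  completion_isometry : forall a, vC (i a) = vL a;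
  completion_dense : forall (z : C) (e : R), 0 < e -> exists a, vC (z - i a) < e;
  completion_complete : forall s : nat -> C,
    (forall e : R, 0 < e ->
       exists N, forall k l, (N <= k)%N -> (N <= l)%N -> vC (s k - s l) < e) ->
    exists z, (fun k => vC (s k - z)) @ \oo --> (0 : R) }.

Section CarlitzEquations.
Variables (R : realType) (F : finFieldType) (C : fieldType) (absC : C -> R).
Variables (q m : nat).

Definition mxabs (A : 'M[C]_m) : R :=
  \big[Num.max/0]_(i < m) \big[Num.max/0]_(j < m) absC (A i j).

Definition mx_series_to (a : nat -> 'M[C]_m) (S : 'M[C]_m) : Prop :=
  (fun n => mxabs (\sum_(k < n) a k - S)) @ \oo --> (0 : R).

Definition tau (k : nat) (A : 'M[C]_m) : 'M[C]_m :=
  map_mx (fun z => z ^+ (q ^ k)) A.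

Definition in_O (t : laurent F) : Prop := laurent_abs R t <= 1.

Definition continuous_on_O (g : laurent F -> 'M[C]_m) : Prop :=
  forall t, in_O t -> forall e : R, 0 < e ->
    exists2 dl : R, 0 < dl &
      forall t', in_O t' -> laurent_abs R (t' - t) < dl -> mxabs (g t' - g t) < e.

(* iota is the embedding of K in C, through which F_q acts on matrices. *)
Definition Fq_linear_on_O (iota : laurent F -> C) (g : laurent F -> 'M[C]_m) :
    Prop :=
  (forall t t', in_O t -> in_O t' -> g (t + t') = g t + g t') /\
  (forall c t, in_O t -> g (laurentC c * t) = iota (laurentC c) *: g t).

(* x is the image in C of the variable laurentX F. *)
Definition carlitz_delta (x : C) (u : laurent F -> 'M[C]_m) (t : laurent F) :
    'M[C]_m :=
  u (laurentX F * t) - x *: u t.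

(* In characteristic p with q a power of p, a q-th root is unique; it exists
   when C is the completion of an algebraically closed field. *)
Definition qroot (z : C) : C := xget 0 [set y | y ^+ q = z].

Definition carlitz_d (x : C) (u : laurent F -> 'M[C]_m) (t : laurent F) :
    'M[C]_m :=
  map_mx qroot (carlitz_delta x u t).

Definition carlitz_bracket (x : C) (k : nat) : C := x ^+ (q ^ k) - x.

Definition W_series (w : nat -> 'M[C]_m) (s : 'M[C]_m) (k : nat) : 'M[C]_m :=
  w k *m tau k s.

Definition pos_radius (w : nat -> 'M[C]_m) : Prop :=
  exists2 r : R, 0 < r &
    forall s, mxabs s < r -> exists S, mx_series_to (W_series w s) S.

End CarlitzEquations.

(* Main.v *)
(* Put B = pi_0 + x, so that g(xt) = B g(t).  Comparing the coefficients of
   tau^k(g), the equation for u = W(g) becomes the Sylvester recursion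
     B w_k - w_k tau^k(B) = - sum_(1 <= j <= k) pi_j tau^j(w_(k-j)).
   B has the eigenvalues mu_i = lambda_i + x, and nonresonance says
   mu_i <> mu_j^(q^k): the recursion is solvable, and B is invertible since
   mu_i = 0 would give mu_i = mu_i^q.  As |B| < 1, tau^k(B) tends to 0, so
   |w_k| is at most |B^-1| times the right-hand side for large k; this yields
   |w_k| <= rho^(q^k - 1).  For rho |g(t)| <= theta < 1 every tail from n on is
   then at most theta^(q^n), a bound on which tau^k acts by n |-> n + k; hence
   the partial sums of P(tau)u can be compared with those of W termwise. *)
From HB Require Import structures.
Require Import Defs.
From mathcomp Require Import all_boot all_order all_algebra all_field.
From mathcomp Require Import zify ring.
From mathcomp Require Import all_classical all_reals all_analysis.
Set Implicit Arguments.
Unset Strict Implicit.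
Unset Printing Implicit Defensive.
Import Order.TTheory GRing.Theory Num.Theory.
Import numFieldNormedType.Exports.
Local Open Scope classical_set_scope.
Local Open Scope ring_scope.

(** * Course-of-values recursion and Sylvester equations *)

(** The auxiliary [h n] is a table that is correct below [n] and has the default [d] elsewhere; as
    [G n] reads only indices below [n], the diagonal [h n.+1 n] is a fixed point. *)
Lemma strong_rec (T : Type) (d : T) (G : nat -> (nat -> T) -> T) :
  (forall n f f', (forall i, (i < n)%N -> f i = f' i) -> G n f = G n f') ->
  exists f, forall n, f n = G n f.
Proof.
move=> Gext.
pose h := fix h n := if n is n'.+1
  then fun i => if i == n' then G n' (h n') else h n' i else fun=> d.
have hE n i : (i < n)%N -> h n i = G i (h i).
  elim: n => // n IH; rewrite ltnS leq_eqVlt /=.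
  by case: eqVneq => [->|_ /IH].
exists (fun n => h n.+1 n) => n; rewrite hE//.
by apply: Gext => i i_n; rewrite !hE.
Qed.

Lemma eigenvalue_addC (K : fieldType) n (N : 'M[K]_n) (a c : K) :
  eigenvalue (N + c%:M) a = eigenvalue N (a - c).
Proof. by rewrite /eigenvalue /eigenspace raddfB/= opprB addrA addrAC. Qed.

Lemma eigenvalue_prod_char (K : fieldType) n (N : 'M[K]_n) (l : 'I_n -> K) a :
  char_poly N = \prod_(i < n) ('X - (l i)%:P) ->
  eigenvalue N a = [exists i, a == l i].
Proof.
move=> Nl; rewrite eigenvalue_root_char Nl /root horner_prod.
apply/prodf_eq0/existsP => -[i]; last by exists i; rewrite ?hornerXsubC ?subr_eq0.
by rewrite hornerXsubC subr_eq0 => _ al; exists i.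
Qed.

Lemma unitmx_eigenvalue (K : fieldType) n (N : 'M[K]_n) (a : K) :
  ~~ eigenvalue N a -> N - a%:M \in unitmx.
Proof. by rewrite /eigenvalue negbK kermx_eq0 row_free_unit. Qed.

(** In finite dimension it suffices that X |-> AX - XN is injective. If AX = XN, then p(A)X = Xp(N)
    for every polynomial p. For p the characteristic polynomial of A the left side is 0 by
    Cayley-Hamilton, while p(N) is a product of invertible factors N - l_i, so X = 0. *)
Lemma sylvester_solvable (K : fieldType) n (A N : 'M[K]_n) (l : 'I_n -> K) :
  char_poly A = \prod_(i < n) ('X - (l i)%:P) ->
  (forall i, ~~ eigenvalue N (l i)) ->
  forall Y, exists X, A *m X - X *m N = Y.
Proof.
(* [horner_mx] requires the ring of matrices of positive size. *)
case: n A N l => [|n] A N l Al Nl Y; first by exists 0; apply/matrixP => -[].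
pose f (X : 'M[K]_n.+1) := A *m X - X *m N.
have f_lin : linear f.
  move=> a X Z; rewrite /f !mulmxDr !mulmxDl -!scalemxAr -!scalemxAl scalerBr.
  by rewrite opprD addrACA.
pose L := GRing.isLinear.Build K _ _ _ f f_lin.
pose fl : {linear 'M[K]_n.+1 -> 'M[K]_n.+1} := HB.pack f L.
have f_inj X : f X = 0 -> X = 0.
  move=> /eqP; rewrite subr_eq0 => /eqP AX.
  have hX p : horner_mx A p *m X = X *m horner_mx N p.
    elim/poly_ind: p => [|p c IH]; first by rewrite !rmorph0 mul0mx mulmx0.
    rewrite !rmorphD !rmorphM/= !horner_mx_C !horner_mx_X.
    rewrite mulmxDl mulmxDr -scalar_mxC; congr (_ + _).
    by rewrite -[LHS]mulmxA AX mulmxA IH mulmxA.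
  have := hX (char_poly A); rewrite Cayley_Hamilton mul0mx => /esym.
  have u : horner_mx N (char_poly A) \in unitmx.
    rewrite Al rmorph_prod.
    apply: (big_ind (fun M : 'M[K]_n.+1 => M \in unitmx)) => [||i _].
    - exact: unitmx1.
    - by move=> M M' uM uM'; rewrite unitmx_mul uM.
    by rewrite rmorphB /= horner_mx_X horner_mx_C; exact: unitmx_eigenvalue.
  by move=> /(congr1 (mulmxr (invmx (horner_mx N (char_poly A))))) /=; rewrite mulmxK// mul0mx.
have fU : lin_mx fl \in unitmx.
  rewrite -row_free_unit; apply: inj_row_free => v.
  rewrite -[v]vec_mxK mul_vec_lin => /eqP; rewrite mxvec_eq0 => /eqP/f_inj ->.
  by rewrite raddf0.
exists (vec_mx (mxvec Y *m invmx (lin_mx fl))).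
apply: (can_inj mxvecK); rewrite -[LHS](mul_vec_lin fl) vec_mxK.
by rewrite mulmxKV.
Qed.

(** * Powers of the Frobenius on a field and on matrices *)

Section PowerFrobenius.
Variables (K : fieldType) (n : nat).

(* [z |-> z ^+ n], with the characteristic hypothesis as a phantom argument
   that makes it inferable as a ring morphism. *)
Definition pow_frob of [pchar K].-nat n := fun z : K => z ^+ n.

Variable nP : [pchar K].-nat n.

Fact pow_frob_is_nmod_morphism : nmod_morphism (pow_frob nP).
Proof.
split=> [|y z]; last exact: exprDn_pchar.
by rewrite /pow_frob expr0n; case: n nP.
Qed.

Fact pow_frob_is_monoid_morphism : monoid_morphism (pow_frob nP).
Proof. by split=> [|y z]; [exact: expr1n | exact: exprMn]. Qed.

HB.instance Definition _ :=
  GRing.isNmodMorphism.Build K K (pow_frob nP) pow_frob_is_nmod_morphism.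
HB.instance Definition _ :=
  GRing.isMonoidMorphism.Build K K (pow_frob nP) pow_frob_is_monoid_morphism.

End PowerFrobenius.

Section Tau.
Variables (K : fieldType) (q m : nat).
Hypothesis qP : [pchar K].-nat q.

Lemma pchar_pow k : [pchar K].-nat (q ^ k)%N.
Proof. by rewrite pnatX qP. Qed.

(** True by conversion; it exposes [tau] as the entrywise action of a ring morphism, from which its
    algebraic rules follow. *)
Lemma tau_frob k (A : 'M[K]_m) : tau q k A = map_mx (pow_frob (pchar_pow k)) A.
Proof. by []. Qed.

Lemma tauB k (A B : 'M[K]_m) : tau q k (A - B) = tau q k A - tau q k B.
Proof. by rewrite !tau_frob map_mxB. Qed.

Lemma tauD k (A B : 'M[K]_m) : tau q k (A + B) = tau q k A + tau q k B.
Proof. by rewrite !tau_frob map_mxD. Qed.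

Lemma tauM k (A B : 'M[K]_m) : tau q k (A *m B) = tau q k A *m tau q k B.
Proof. by rewrite !tau_frob map_mxM. Qed.

Lemma tau_scalar k (c : K) : tau q k c%:M = (c ^+ (q ^ k))%:M :> 'M[K]_m.
Proof. by rewrite !tau_frob map_scalar_mx. Qed.

Lemma tau_tau j k (A : 'M[K]_m) : tau q j (tau q k A) = tau q (j + k) A.
Proof. by apply/matrixP => a b; rewrite !mxE -exprM -expnD addnC. Qed.

Lemma tau0 (A : 'M[K]_m) : tau q 0 A = A.
Proof. by apply/matrixP => a b; rewrite !mxE. Qed.

Lemma char_poly_tau k (A : 'M[K]_m) (l : 'I_m -> K) :
  char_poly A = \prod_(i < m) ('X - (l i)%:P) ->
  char_poly (tau q k A) = \prod_(i < m) ('X - (l i ^+ (q ^ k))%:P).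
Proof.
move=> Al; rewrite tau_frob -map_char_poly Al rmorph_prod/=.
by apply: eq_bigr => i _; rewrite map_polyXsubC.
Qed.

End Tau.

(** * Ultrametric absolute values and the maximum norm on matrices *)

Section Absval.
Variables (R : realType) (K : fieldType) (v : K -> R).
Hypothesis vP : is_absval v.

Lemma absval0 : v 0 = 0.
Proof. by apply/(absval_eq0 vP). Qed.

Lemma absval1 : v 1 = 1.
Proof.
have v1 : v 1 != 0.
  by apply/eqP => /(absval_eq0 vP)/eqP; rewrite oner_eq0.
by apply: (mulfI v1); rewrite mulr1 -(absvalM vP) mulr1.
Qed.

Lemma absvalN a : v (- a) = v a.
Proof.
apply/eqP; rewrite -(@eqrXn2 _ 2) ?(absval_ge0 vP)//.
by rewrite !expr2 -!(absvalM vP) mulrNN.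
Qed.

Lemma absvalX a n : v (a ^+ n) = v a ^+ n.
Proof. by elim: n => [|n IH]; rewrite ?absval1// !exprS (absvalM vP) IH. Qed.

Lemma absval_sum_le (I : Type) (r : seq I) (P : pred I) (E : I -> K) (b : R) :
  0 <= b -> (forall i, P i -> v (E i) <= b) -> v (\sum_(i <- r | P i) E i) <= b.
Proof.
move=> b0 Eb; elim/big_ind: _ => [|y z yb zb|//]; first by rewrite absval0.
by apply: le_trans (absvalD vP _ _) _; rewrite ge_max yb.
Qed.

Section Matrices.
Variable m : nat.
Implicit Types A B : 'M[K]_m.

Lemma mxabs_ge0 A : 0 <= mxabs v A.
Proof. exact: bigmax_ge_id. Qed.

Lemma mxabs_le A (b : R) : 0 <= b -> (mxabs v A <= b) <-> (forall i j, v (A i j) <= b).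
Proof.
move=> b0; split=> [Ab i j|Ab].
  by apply: le_trans Ab; apply: le_trans (le_bigmax 0 _ i); exact: (le_bigmax 0 _ j).
by apply: bigmax_le => // i _; apply: bigmax_le.
Qed.

Lemma mxabs_entry A i j : v (A i j) <= mxabs v A.
Proof. by move: i j; apply/mxabs_le; rewrite // mxabs_ge0. Qed.

Lemma mxabs0 : mxabs v (0 : 'M[K]_m) = 0.
Proof.
apply/eqP; rewrite eq_le mxabs_ge0 andbT; apply/mxabs_le => // i j.
by rewrite mxE absval0.
Qed.

Lemma mxabsN A : mxabs v (- A) = mxabs v A.
Proof. by apply: eq_bigr => i _; apply: eq_bigr => j _; rewrite mxE absvalN. Qed.

Lemma mxabsD_le A B (b : R) :
  mxabs v A <= b -> mxabs v B <= b -> mxabs v (A + B) <= b.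
Proof.
move=> Ab Bb; have b0 : 0 <= b := le_trans (mxabs_ge0 A) Ab.
apply/mxabs_le => // i j; rewrite mxE.
apply: le_trans (absvalD vP _ _) _.
by rewrite ge_max !(le_trans (mxabs_entry _ _ _)).
Qed.

Lemma mxabsB_le A B (b : R) :
  mxabs v A <= b -> mxabs v B <= b -> mxabs v (A - B) <= b.
Proof. by move=> Ab Bb; apply: mxabsD_le; rewrite ?mxabsN. Qed.

Lemma mxabs_sum_le (I : Type) (r : seq I) (P : pred I) (E : I -> 'M[K]_m) (b : R) :
  0 <= b -> (forall i, P i -> mxabs v (E i) <= b) ->
  mxabs v (\sum_(i <- r | P i) E i) <= b.
Proof.
move=> b0 Eb; elim/big_ind: _ => [|y z yb zb|//]; first by rewrite mxabs0.
exact: mxabsD_le.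
Qed.

(** The entries of a product are sums of [m] terms, but the ultrametric inequality produces no
    factor [m]. *)
Lemma mxabsM_le A B (a b : R) :
  mxabs v A <= a -> mxabs v B <= b -> mxabs v (A *m B) <= a * b.
Proof.
move=> Aa Bb; have a0 : 0 <= a := le_trans (mxabs_ge0 A) Aa.
have b0 : 0 <= b := le_trans (mxabs_ge0 B) Bb.
apply/mxabs_le => [|i j]; first exact: mulr_ge0.
rewrite mxE; apply: absval_sum_le => [|k _]; first exact: mulr_ge0.
rewrite (absvalM vP) ler_pM ?(absval_ge0 vP)//.
  exact: le_trans (mxabs_entry _ _ _) Aa.
exact: le_trans (mxabs_entry _ _ _) Bb.
Qed.

Lemma mxabsZ_le c A (a b : R) :
  v c <= a -> mxabs v A <= b -> mxabs v (c *: A) <= a * b.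
Proof.
move=> ca Ab; have a0 : 0 <= a := le_trans (absval_ge0 vP c) ca.
have b0 : 0 <= b := le_trans (mxabs_ge0 A) Ab.
apply/mxabs_le => [|i j]; first exact: mulr_ge0.
rewrite mxE (absvalM vP) ler_pM ?(absval_ge0 vP)//.
exact: le_trans (mxabs_entry _ _ _) Ab.
Qed.

Lemma mxabs_scalar_le c : mxabs v (c%:M : 'M[K]_m) <= v c.
Proof.
apply/mxabs_le => [|i j]; first exact: (absval_ge0 vP).
by rewrite mxE; case: eqP => _; rewrite ?mulr1n// mulr0n absval0 (absval_ge0 vP).
Qed.

Lemma mxabs_tau_le q k A (a : R) :
  mxabs v A <= a -> mxabs v (tau q k A) <= a ^+ (q ^ k).
Proof.
move=> Aa; have a0 : 0 <= a := le_trans (mxabs_ge0 A) Aa.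
apply/mxabs_le => [|i j]; first exact: exprn_ge0.
rewrite mxE absvalX lerXn2r ?nnegrE ?(absval_ge0 vP)//.
exact: le_trans (mxabs_entry _ _ _) Aa.
Qed.

End Matrices.
End Absval.

(** * Convergence of series in the completion *)

Section Convergence.
Variables (R : realType) (L K : fieldType) (vL : L -> R) (v : K -> R).
Variable (i : {rmorphism L -> K}).
Hypothesis Kc : is_completion vL v i.
Let vP := completion_absval Kc.

(** Here [b n] bounds every term from [n] on. By the ultrametric inequality it also bounds the
    differences of later partial sums from the [n]-th, so each entry is Cauchy, and the bound passes
    to the limit unchanged. *)
Lemma bounded_series_cvg m (a : nat -> 'M[K]_m) (b : nat -> R) :
  (forall n k, (n <= k)%N -> mxabs v (a k) <= b n) -> b @ \oo --> 0 ->
  exists S, forall n, mxabs v (\sum_(k < n) a k - S) <= b n.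
Proof.
move=> ab b0.
have b_ge0 n : 0 <= b n by apply: le_trans (ab n n _); rewrite ?mxabs_ge0.
pose s n := \sum_(k < n) a k.
have s_le n k : (n <= k)%N -> mxabs v (s n - s k) <= b n.
  move=> nk; rewrite -mxabsN// opprB /s -!(big_mkord xpredT a).
  rewrite (big_cat_nat (leq0n n) nk)//= (addrC _ (- _)) addKr big_nat_cond.
  by apply: mxabs_sum_le => // l; rewrite andbT => /andP[/ab].
have b_near (d : R) : 0 < d -> exists N, forall n, (N <= n)%N -> b n < d.
  move=> d0; have /cvgrPdist_lt/(_ _ d0)[N _ bN] := b0.
  by exists N => n /bN /=; rewrite sub0r normrN ger0_norm.
have lims i0 j : exists z, (fun n => v (s n i0 j - z)) @ \oo --> (0 : R).
  apply: (completion_complete Kc) => d /b_near[N bN]; exists N => k l Nk Nl.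
  have H n : (N <= n)%N -> v (s N i0 j - s n i0 j) < d.
    move=> /s_le sNn; apply: le_lt_trans (bN N _) => //.
    by apply: le_trans sNn; rewrite -[_ - _](_ : (s N - s n) i0 j = _) ?mxabs_entry ?mxE.
  rewrite (_ : _ - _ = (s N i0 j - s l i0 j) - (s N i0 j - s k i0 j)); last first.
    by rewrite opprB [RHS]addrC addrA subrK.
  apply: le_lt_trans (absvalD vP _ _) _; rewrite absvalN//.
  by rewrite gt_max !H.
pose z i0 j := sval (cid (lims i0 j)).
have zP i0 j : (fun n => v (s n i0 j - z i0 j)) @ \oo --> (0 : R).
  exact: svalP (cid (lims i0 j)).
exists (\matrix_(i0, j) z i0 j) => n; apply/mxabs_le => // i0 j.
(* The bound is proved up to any [d > 0], by passing through a partial sum [s k] with [k] beyond [n]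
   that is within [d] of the limit. *)
rewrite !mxE -/(s n); apply/ler_addgt0Pr => d d0.
have /cvgrPdist_lt/(_ _ d0)[N _ /(_ (maxn N n) (leq_maxl _ _))] := zP i0 j.
set k := maxn N n; rewrite /= sub0r normrN ger0_norm ?(absval_ge0 vP)// => vk.
have -> : (\sum_(k0 < n) a k0) i0 j - z i0 j =
    (s n - s k) i0 j + (s k i0 j - z i0 j) by rewrite !mxE addrA subrK.
apply: le_trans (absvalD vP _ _) _; rewrite ge_max; apply/andP; split.
  apply: le_trans (mxabs_entry v _ _ _) _.
  by apply: le_trans (s_le n k (leq_maxr _ _)) _; rewrite lerDl ltW.
by apply: le_trans (ltW vk) _; rewrite lerDr.
Qed.

Lemma mx_series_to_le m (a : nat -> 'M[K]_m) S (b : nat -> R) :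
  (forall n, mxabs v (\sum_(k < n) a k - S) <= b n) -> b @ \oo --> 0 ->
  mx_series_to v a S.
Proof.
move=> ab b0; apply: (squeeze_cvgr _ (cvg_cst 0) b0).
by apply: nearW => n; rewrite ab mxabs_ge0.
Qed.

End Convergence.

(** As n < q^n, the sequence lies between 0 and c^n. *)
Lemma cvg_expr_pow (R : realType) (q : nat) (c : R) : (1 < q)%N ->
  0 <= c -> c < 1 -> (fun n => c ^+ (q ^ n)) @ \oo --> 0.
Proof.
move=> q1 c0 c1; have cn : (fun n => c ^+ n) @ \oo --> 0.
  by apply: cvg_expr; rewrite ger0_norm.
apply: (squeeze_cvgr _ (cvg_cst 0) cn); apply: nearW => n.
by rewrite exprn_ge0//= ler_wiXn2l// ?(ltW c1)// ltnW// ltn_expl.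
Qed.

(** * Roots of order q and the Carlitz derivative *)

(** By density [z] is a limit of q-th powers of elements of the algebraically closed [L]. Since (a -
    b)^q = a^q - b^q, the roots form a Cauchy sequence as their powers do, and their limit is a root
    of [z]. *)
Lemma completion_qroot (R : realType) (L : closedFieldType) (K : fieldType)
  (vL : L -> R) (v : K -> R) (i : {rmorphism L -> K}) (q : nat) :
  is_completion vL v i -> [pchar K].-nat q ->
  forall z : K, exists y, y ^+ q = z.
Proof.
move=> Kc qP z; have vP := completion_absval Kc.
have q0 : (0 < q)%N by case/andP: qP.
have powB a b : (a - b) ^+ q = a ^+ q - b ^+ q := rmorphB (pow_frob qP) a b.
have /choice[b bz] : forall n, exists b, v (z - i b ^+ q) < n.+1%:R^-1.
  move=> n.
  have n_gt0 : 0 < n.+1%:R^-1 :> R by rewrite invr_gt0.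
  have [a az] := completion_dense Kc z n_gt0.
  have /closed_rootP[b] : size ('X^q - a%:P : {poly L}) != 1%N.
    by rewrite size_XnsubC// eqSS -lt0n.
  rewrite rootE !hornerE subr_eq0 => /eqP ba; exists b.
  by rewrite -rmorphXn ba.
have near0 (d : R) : 0 < d -> exists N, forall n, (N <= n)%N ->
    v (z - i (b n) ^+ q) < d ^+ q.
  move=> d0; have [N _ dN] := near_infty_natSinv_lt (PosNum (exprn_gt0 q d0)).
  by exists N => n /dN; apply: lt_trans.
have [|y by_] := @completion_complete _ _ _ _ _ _ Kc (fun n => i (b n)).
  move=> d /[dup] d0 /near0[N bN]; exists N => k l Nk Nl.
  rewrite -(@ltr_pXn2r _ q) ?nnegrE ?(absval_ge0 vP) ?(ltW d0)//.
  rewrite -absvalX// powB -(subrKA z) -opprB.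
  apply: le_lt_trans (absvalD vP _ _) _.
  by rewrite absvalN// gt_max !bN.
exists y; apply/eqP; rewrite -subr_eq0; apply/eqP/(absval_eq0 vP)/eqP.
rewrite eq_le (absval_ge0 vP) andbT leNgt; apply/negP => c0.
(* With [d] at most 1 and at most [c], one has d^q <= d <= c, so approximation within d^q gives the
   contradiction c < c. *)
set c := v _ in c0; pose d := Num.min 1 c.
have d0 : 0 < d by rewrite lt_min ltr01.
have /cvgrPdist_lt/(_ _ d0)[N1 _ yN] := by_; have [N2 bN] := near0 _ d0.
have := yN (maxn N1 N2) (leq_maxl _ _).
have := bN (maxn N1 N2) (leq_maxr _ _); set n := maxn _ _.
rewrite /= sub0r normrN ger0_norm ?(absval_ge0 vP)// => bn yn.
suff : c < c by rewrite ltxx.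
apply: (@lt_le_trans _ _ (d ^+ q)); last first.
  apply: (@le_trans _ _ d); last by rewrite ge_min lexx orbT.
  by rewrite ler_iXnr// ?(ltW d0)// ge_min lexx.
have -> : c = v ((i (b n) - y) ^+ q + (z - i (b n) ^+ q)).
  by rewrite powB addrC addrA subrK /c -absvalN// opprB.
apply: le_lt_trans (absvalD vP _ _) _.
by rewrite gt_max bn andbT absvalX// ltrXn2r ?(absval_ge0 vP)// -lt0n.
Qed.

(** Existence of roots ensures that [qroot] never takes its default value. *)
Lemma tau_carlitz_d (F : finFieldType) (C : fieldType) (q m : nat) (x : C)
  (u : laurent F -> 'M[C]_m) t :
  (forall z : C, exists y, y ^+ q = z) ->
  tau q 1 (carlitz_d q x u t) = carlitz_delta x u t.
Proof.
move=> root_ex; apply/matrixP => a b; rewrite !mxE expn1.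
exact: (@xgetPex _ 0 [set y | y ^+ q = _] (root_ex _)).
Qed.

(** * Solving the recursion for the coefficients *)

Section Coefficients.
Variables (C : fieldType) (q m : nat).
Hypothesis qP : [pchar C].-nat q.
Variables (x : C) (pi : nat -> 'M[C]_m) (l : 'I_m -> C).
Hypothesis pi0_l : char_poly (pi 0%N) = \prod_(i < m) ('X - (l i)%:P).
Hypothesis nonres : forall i j k, (0 < k)%N ->
  l i - l j ^+ (q ^ k) != carlitz_bracket q x k.

Let B := pi 0%N + x%:M.

(** If [B] were singular, some [l i] would equal [- x]; additivity of the Frobenius then gives l_i -
    l_i^q = x^q - x = [1], which is excluded. *)
Lemma nonresonant_unitmx : B \in unitmx.
Proof.
rewrite /B -[x]opprK raddfN; apply: unitmx_eigenvalue.
rewrite (eigenvalue_prod_char _ pi0_l); apply/existsP => -[i /eqP xl].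
have /negP := @nonres i i 1 isT; apply; rewrite -xl /carlitz_bracket.
rewrite -[(- x) ^+ _]/(pow_frob (pchar_pow qP 1) (- x)) rmorphN opprK addrC.
by [].
Qed.

Lemma nonresonant_coefficients : exists w : nat -> 'M[C]_m, w 0%N = 1%:M /\
  forall k, w k *m tau q k B - x *: w k =
    \sum_(j < k.+1) pi j *m tau q j (w (k - j)%N).
Proof.
pose rhs k (f : nat -> 'M[C]_m) :=
  \sum_(j < k) pi j.+1 *m tau q j.+1 (f (k - j.+1)%N).
pose eqn k f := [set X | X *m tau q k B - x *: X = pi 0%N *m X + rhs k f].
have [|w wE] := @strong_rec _ 0
    (fun k f => if k == 0%N then 1%:M else xget 0 (eqn k f)).
  move=> n f f' ff'; rewrite /eqn (_ : rhs n f = rhs n f')//.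
  by apply: eq_bigr => j _; rewrite ff'//; have := ltn_ord j; lia.
have w0 : w 0%N = 1%:M by rewrite wE.
exists w; split=> // k; rewrite big_ord_recl /= tau0 subn0.
case: (posnP k) => [->|k0].
  by rewrite big_ord0 w0 mul1mx mulmx1 tau0 scalemx1 /B addrK addr0.
suff : eqn k w (w k) by [].
rewrite [X in _ X]wE gtn_eqF//.
apply: xgetPex.
(* The summand [j = 0] is moved to the left. The eigenvalues of tau^k(B) - x are l_j^(q^k) + [k],
   which by nonresonance differ from all [l i]. *)
have [|X XE] := @sylvester_solvable _ _ (pi 0%N) (tau q k B - x%:M) l pi0_l _ (- rhs k w).
  move=> i; rewrite /B tauD// tau_scalar// -addrA -raddfB eigenvalue_addC.
  rewrite (eigenvalue_prod_char _ (char_poly_tau qP k pi0_l)).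
  apply/existsP => -[j /eqP ij]; have /negP := @nonres i j k k0; apply.
  by rewrite -ij opprB addrCA subrr addr0.
exists X; rewrite /eqn /=; move/eqP: XE; rewrite mulmxBr mul_mx_scalar.
by rewrite subr_eq addrC -subr_eq opprK => /eqP <-; rewrite addrC.
Qed.

End Coefficients.

(** * Growth of the coefficients *)

Section Growth.
Variables (R : realType) (C : fieldType) (v : C -> R) (q m : nat).
Hypotheses (vP : is_absval v) (q_gt1 : (1 < q)%N).
Variables (x : C) (pi w : nat -> 'M[C]_m).
Let B := pi 0%N + x%:M.
Hypothesis w_rec : forall k, w k *m tau q k B - x *: w k =
  \sum_(j < k.+1) pi j *m tau q j (w (k - j)%N).
Hypothesis B_lt1 : mxabs v B < 1.
Variable gamma : R.
Hypothesis pi_le : forall k, mxabs v (pi k) <= gamma.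

Let gamma_ge0 : 0 <= gamma := le_trans (mxabs_ge0 v (pi 0%N)) (pi_le 0).

(* As [|B| < 1], the term [w k *m tau q k B] of the Sylvester equation for
   [w k] becomes negligible for large [k], leaving [w k = - invmx B *m rhs]. *)
Lemma coefficient_step k (y : R) : B \in unitmx ->
  mxabs v (invmx B) * mxabs v B ^+ (q ^ k) < 1 ->
  mxabs v (\sum_(j < k) pi j.+1 *m tau q j.+1 (w (k - j.+1)%N)) <= y ->
  mxabs v (w k) <= mxabs v (invmx B) * y.
Proof.
move=> Bu small Yy; set Y := \sum_(j < k) _ in Yy.
have wk : w k = invmx B *m (w k *m tau q k B - Y).
  have := w_rec k; rewrite big_ord_recl /= tau0 subn0 -/Y => /eqP.
  rewrite subr_eq addrAC -mul_scalar_mx -mulmxDl -/B -subr_eq => /eqP ->.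
  by rewrite mulKmx.
rewrite leNgt; apply/negP => ltw.
have w_gt0 : 0 < mxabs v (w k).
  apply: le_lt_trans ltw; rewrite mulr_ge0 ?mxabs_ge0//.
  exact: le_trans (mxabs_ge0 v Y) Yy.
have wt := mxabsM_le vP (lexx (mxabs v (w k))) (mxabs_tau_le vP q k (lexx (mxabs v B))).
(* If [y] dominates, the claimed bound follows at once; otherwise |w_k| <= |B^-1| |B|^(q^k) |w_k| <
   |w_k|. *)
have [le_y|lt_y] := leP (mxabs v (w k) * mxabs v B ^+ (q ^ k)) y.
  have := mxabsM_le vP (lexx (mxabs v (invmx B))) (mxabsB_le vP (le_trans wt le_y) Yy).
  by rewrite -wk leNgt ltw.
have := mxabsM_le vP (lexx (mxabs v (invmx B))) (mxabsB_le vP wt (le_trans Yy (ltW lt_y))).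
by rewrite -wk mulrCA leNgt gtr_pMr// small.
Qed.

(** The [- 1] in the exponent closes the induction: tau^(j+1) turns the bound for w_(k-j-1) into
    rho^(q^k - q^(j+1)), at most rho^(q^k - q), which leaves a spare factor rho to absorb |B^-1|
    gamma. *)
Lemma coefficient_growth : B \in unitmx -> w 0%N = 1%:M ->
  exists2 rho : R, 1 <= rho & forall k, mxabs v (w k) <= rho ^+ (q ^ k - 1).
Proof.
move=> Bu w0; set b := mxabs v (invmx B).
have b0 : 0 <= b := mxabs_ge0 _ _.
have [k0 small] : exists k0, forall k, (k0 <= k)%N -> b * mxabs v B ^+ (q ^ k) < 1.
  (* [b + 1] is inverted since [b] is only known to be nonnegative. *)
  have b1 : 0 < (b + 1)^-1 by rewrite invr_gt0 ltr_wpDl.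
  have /cvgrPdist_lt/(_ _ b1)[k0 _ kB] := cvg_expr_pow q_gt1 (mxabs_ge0 v B) B_lt1.
  exists k0 => k /kB /=; rewrite sub0r normrN ger0_norm ?exprn_ge0 ?mxabs_ge0// => Bk.
  apply: le_lt_trans (ler_wpM2l b0 (ltW Bk)) _.
  by rewrite ltr_pdivrMr ?mul1r ?ltrDl// ltr_wpDl.
(* The three summands give rho >= 1, the constant for the induction step, and the bound for the
   finitely many [k < k0]. *)
pose rho := 1 + b * gamma + \sum_(k < k0) mxabs v (w k).
have s0 : 0 <= \sum_(k < k0) mxabs v (w k) by apply: sumr_ge0 => k _; exact: mxabs_ge0.
have rho1 : 1 <= rho by rewrite /rho -addrA lerDl addr_ge0// mulr_ge0.
have rho0 : 0 <= rho := le_trans ler01 rho1.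
exists rho => // k; elim/ltn_ind: k => k IH.
have [->|k_gt0] := posnP k.
  by rewrite w0 expn0 subnn expr0; apply: le_trans (mxabs_scalar_le vP _ _) _; rewrite absval1.
have qk : (q <= q ^ k)%N by rewrite -[X in (X <= _)%N]expn1 leq_exp2l.
have [kk0|k0k] := ltnP k k0.
  apply: (@le_trans _ _ rho).
    rewrite /rho (bigD1 (Ordinal kk0))//= addrCA lerDl addr_ge0 ?addr_ge0 ?mulr_ge0//.
    by apply: sumr_ge0 => j _; exact: mxabs_ge0.
  by rewrite -[X in X <= _]expr1 ler_weXn2l//; lia.
apply: (@le_trans _ _ (b * (gamma * rho ^+ (q ^ k - q)))).
  apply: coefficient_step => //; first exact: small.
  apply: mxabs_sum_le => // [|j _]; first by rewrite mulr_ge0 ?exprn_ge0.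
  apply: mxabsM_le => //; apply: le_trans (mxabs_tau_le vP q j.+1 (IH (k - j.+1)%N _)) _.
    by rewrite ltn_subrL.
  rewrite -exprM ler_weXn2l// mulnBl mul1n -expnD subnK ?ltn_ord//.
  by apply: leq_sub2l; rewrite -[X in (X <= _)%N]expn1 leq_exp2l.
rewrite mulrA (_ : (q ^ k - 1 = 1 + (q ^ k - q) + (q - 2))%N); last lia.
rewrite 2!exprD expr1 -[X in X <= _]mulr1 ler_pM ?exprn_ege1//.
  by rewrite !mulr_ge0// exprn_ge0.
apply: ler_pM; rewrite ?mulr_ge0// ?exprn_ge0//.
by rewrite /rho addrAC lerDr addr_ge0.
Qed.

(** * The equation at one point: [G], [G'], [S], [S'] stand for g(t), g(xt), u(t), u(xt) *)

Hypotheses (qP : [pchar C].-nat q) (x_le1 : v x <= 1).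
Variables (G G' S S' : 'M[C]_m) (theta : R).
Hypotheses (theta_ge0 : 0 <= theta) (theta_lt1 : theta < 1).
Hypothesis G'E : G' = B *m G.
Hypothesis S_lim :
  forall n, mxabs v (\sum_(k < n) W_series q w G k - S) <= theta ^+ (q ^ n).
Hypothesis S'_lim :
  forall n, mxabs v (\sum_(k < n) W_series q w G' k - S') <= theta ^+ (q ^ n).

Let partial (H : 'M[C]_m) n := \sum_(k < n) W_series q w H k.

(** Cutting the argument of tau^k at [n - k] leaves exactly the terms in tau^i(G) with i < n on both
    sides, so the identity is exact; the increment from [n] to [n.+1] is the recursion for [w n]. *)
Lemma truncated_equation n :
  \sum_(k < n) pi k *m tau q k (partial G (n - k)) = partial G' n - x *: partial G n.
Proof.
elim: n => [|n IH]; first by rewrite /partial !big_ord0 scaler0 subr0.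
rewrite /partial [X in X - _]big_ord_recr [X in _ - _ *: X]big_ord_recr /=.
rewrite -/(partial G' n) -/(partial G n) scalerDr opprD addrACA -IH.
have -> : W_series q w G' n - x *: W_series q w G n =
    \sum_(k < n.+1) pi k *m tau q k (W_series q w G (n - k)).
  rewrite /W_series G'E tauM// mulmxA scalemxAl -mulmxBl w_rec mulmx_suml.
  apply: eq_bigr => k _; rewrite tauM// tau_tau subnKC ?mulmxA//.
  by rewrite -ltnS ltn_ord.
transitivity (\sum_(k < n.+1) pi k *m tau q k (partial G (n - k)) +
    \sum_(k < n.+1) pi k *m tau q k (W_series q w G (n - k))).
  rewrite -big_split; apply: eq_bigr => k _ /=; rewrite -mulmxDr -tauD//.
  by rewrite /partial subSn ?big_ord_recr// -ltnS ltn_ord.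
(* The extra summand [k = n] carries an empty partial sum. *)
congr (_ + _); rewrite big_ord_recr /= subnn /partial big_ord0.
rewrite [tau q n 0](_ : _ = 0) ?mulmx0 ?addr0//.
by rewrite (tau_frob qP) map_mx0.
Qed.

Lemma series_solves_equation :
  mx_series_to v (fun k => pi k *m tau q k S) (S' - x *: S).
Proof.
(* The 1 serves the errors of [S'] and [S], gamma those under the [pi k]. *)
pose c n := Num.max gamma 1 * theta ^+ (q ^ n).
have th_c n : theta ^+ (q ^ n) <= c n.
  by rewrite ler_peMl ?exprn_ge0// le_max lexx orbT.
have gth_c n : gamma * theta ^+ (q ^ n) <= c n.
  by rewrite ler_wpM2r ?exprn_ge0// le_max lexx.
apply: (@mx_series_to_le _ _ _ _ _ _ c); last first.
  rewrite /c -[X in _ --> X](mulr0 (Num.max gamma 1)).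
  by apply: cvgMr; exact: cvg_expr_pow.
move=> n.
(* By the truncated equation the error splits into tails of W; tau^k raises the bound
   theta^(q^(n-k)) to theta^(q^n), whatever [k] is. *)
have -> : \sum_(k < n) pi k *m tau q k S - (S' - x *: S) =
    (partial G' n - S') - x *: (partial G n - S) -
    \sum_(k < n) pi k *m tau q k (partial G (n - k) - S).
  have -> : \sum_(k < n) pi k *m tau q k (partial G (n - k) - S) =
      (partial G' n - x *: partial G n) - \sum_(k < n) pi k *m tau q k S.
    rewrite -truncated_equation -sumrB; apply: eq_bigr => k _.
    by rewrite tauB// mulmxBr.
  set T := \sum_(k < n) _; set X := partial G' n; rewrite scalerBr.
  set Y := x *: partial G n; set Z := x *: S.
  by apply/matrixP => i j; rewrite !mxE; ring.
have c0 : 0 <= c n by apply: le_trans (th_c n); rewrite exprn_ge0.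
apply: (mxabsB_le vP); first apply: (mxabsB_le vP).
- exact: le_trans (S'_lim n) (th_c n).
- apply: le_trans (mxabsZ_le vP x_le1 (S_lim n)) _.
  by rewrite mul1r.
apply: (mxabs_sum_le vP) => // k _.
apply: le_trans (gth_c n); apply: (mxabsM_le vP) => //.
rewrite (_ : (q ^ n = q ^ (n - k) * q ^ k)%N) ; last first.
  by rewrite -expnD subnK// ltnW.
rewrite exprM; exact: (mxabs_tau_le vP q k (S_lim _)).
Qed.

End Growth.

(** * Convergence of W and proof of the theorem *)

Lemma W_term_le (R : realType) (C : fieldType) (v : C -> R) (q m : nat)
  (w : nat -> 'M[C]_m) (rho theta : R) (s : 'M[C]_m) n k :
  is_absval v -> (1 < q)%N -> 1 <= rho ->
  (forall k, mxabs v (w k) <= rho ^+ (q ^ k - 1)) ->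
  rho * mxabs v s <= theta -> theta < 1 -> (n <= k)%N ->
  mxabs v (W_series q w s k) <= theta ^+ (q ^ n).
Proof.
move=> vP q1 rho1 w_le s_th th1 nk; have rho0 := le_trans ler01 rho1.
have s0 := mxabs_ge0 v s.
apply: (@le_trans _ _ ((rho * mxabs v s) ^+ (q ^ k))).
  apply: le_trans (mxabsM_le vP (w_le k) (mxabs_tau_le vP q k (lexx _))) _.
  by rewrite exprMn ler_wpM2r ?exprn_ge0// ler_weXn2l// leq_subr.
have rs0 : 0 <= rho * mxabs v s by rewrite mulr_ge0.
apply: (@le_trans _ _ (theta ^+ (q ^ k))).
  by rewrite lerXn2r// nnegrE (le_trans rs0).
by rewrite ler_wiXn2l ?(ltW th1) ?(le_trans rs0)// leq_exp2l.
Qed.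
(** Used to carry the characteristic of [F] over to [C]. *)
Lemma laurent_nat (F : fieldType) n : n%:R = laurentC (n%:R : F).
Proof.
elim: n => [|n IH]; first by apply: laurent_ext => j /=; case: ifP.
rewrite !mulrSr IH; apply: laurent_ext => j /=.
by case: ifP => //; rewrite addr0.
Qed.

Lemma laurent_absX (R : realType) (F : finFieldType) :
  laurent_abs R (laurentX F) = #|F|%:R^-1.
Proof.
rewrite (@laurent_absE _ _ _ 1) ?exprN1//; split=> [|j]/=.
  exact: oner_neq0.
by rewrite lt_neqAle => /andP[/negPf->].
Qed.

Theorem theorem2 (R : realType) (p e q : nat) (p_prime : prime p)
  (e_gt0 : (0 < e)%N) (qE : q = (p ^ e)%N)
  (F : finFieldType) (cardF : #|F| = q)
  (Kbar : closedFieldType) (jK : {rmorphism laurent F -> Kbar})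
  (Kbar_closure : is_alg_closure jK)
  (absKbar : Kbar -> R) (absKbar_absval : is_absval absKbar)
  (absKbar_ext : forall t, absKbar (jK t) = laurent_abs R t)
  (C : fieldType) (jC : {rmorphism Kbar -> C}) (absC : C -> R)
  (C_completion : is_completion absKbar absC jC)
  (x : C) (xE : x = jC (jK (laurentX F)))
  (m : nat) (m_gt0 : (0 < m)%N)
  (pi : nat -> 'M[C]_m) (gamma : R) (gamma_gt0 : 0 < gamma)
  (pi_bound : forall k, mxabs absC (pi k) <= gamma)
  (pi0_small : mxabs absC (pi 0%N) < 1)
  (g : laurent F -> 'M[C]_m)
  (g_continuous : continuous_on_O absC g)
  (g_linear : Fq_linear_on_O R (fun t => jC (jK t)) g)
  (g_solution : forall t, in_O R t ->
     tau q 1 (carlitz_d q x g t) = pi 0%N *m g t)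
  (lambda : 'I_m -> C)
  (lambda_eigenvalues :
     char_poly (pi 0%N) = \prod_(i < m) ('X - (lambda i)%:P))
  (nonresonance : forall (i j : 'I_m) (k : nat), (0 < k)%N ->
     lambda i - lambda j ^+ (q ^ k) != carlitz_bracket q x k) :
  exists w : nat -> 'M[C]_m,
    [/\ w 0%N = 1%:M,
        pos_radius absC q w &
        exists u : laurent F -> 'M[C]_m, exists2 delta : R, 0 < delta &
          forall t, in_O R t -> laurent_abs R t < delta ->
            mx_series_to absC (W_series q w (g t)) (u t) /\
            exists2 Pu : 'M[C]_m,
              mx_series_to absC (fun k => pi k *m tau q k (u t)) Pu &
              tau q 1 (carlitz_d q x u t) - Pu = 0].
Proof.
have vP := completion_absval C_completion.
have q_gt1 : (1 < q)%N by rewrite qE -(exp1n e) ltn_exp2r// prime_gt1.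
have qP : [pchar C].-nat q.
  have pF : p \in [pchar F] by apply: (@card_finPcharP _ _ e); rewrite ?cardF.
  have pC : p \in [pchar C].
    rewrite inE p_prime/= -(rmorph_nat jC) -(rmorph_nat jK) laurent_nat pcharf0//.
    by rewrite -(laurent_nat F 0) !rmorph0.
  by rewrite qE pnatX pnatE// pC.
have root_ex := completion_qroot C_completion qP.
have abs_jK t : absC (jC (jK t)) = laurent_abs R t.
  by rewrite (completion_isometry C_completion) absKbar_ext.
have x_lt1 : absC x < 1.
  by rewrite xE abs_jK laurent_absX cardF invf_lt1 ?ltr0n ?ltr1n// ltnW.
have absX t : laurent_abs R (laurentX F * t) <= laurent_abs R t.
  rewrite -!abs_jK !rmorphM (absvalM vP) -xE ler_piMl ?(ltW x_lt1)//.
  exact: absval_ge0 vP _.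
have OX t : in_O R t -> in_O R (laurentX F * t) := le_trans (absX t).
pose B := pi 0%N + x%:M.
have B_lt1 : mxabs absC B < 1.
  apply: (@le_lt_trans _ _ (Num.max (mxabs absC (pi 0%N)) (absC x))).
    apply: (mxabsD_le vP); rewrite le_max ?lexx//.
    by rewrite (mxabs_scalar_le vP) orbT.
  by rewrite gt_max pi0_small.
have Bu : B \in unitmx := nonresonant_unitmx qP lambda_eigenvalues nonresonance.
have [w [w0 w_rec]] := nonresonant_coefficients qP lambda_eigenvalues nonresonance.
have [rho rho1 w_le] := coefficient_growth vP q_gt1 w_rec B_lt1 pi_bound Bu w0.
have rho_gt0 : 0 < rho := lt_le_trans ltr01 rho1.
have W_cvg s : rho * mxabs absC s < 1 -> exists S, forall n,
    mxabs absC (\sum_(k < n) W_series q w s k - S) <= (rho * mxabs absC s) ^+ (q ^ n).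
  move=> s1; apply: (bounded_series_cvg C_completion).
    by move=> n k; apply: (W_term_le vP q_gt1 rho1 w_le).
  by apply: cvg_expr_pow; rewrite // mulr_ge0 ?(ltW rho_gt0) ?mxabs_ge0.
exists w; split=> //.
  exists rho^-1; first by rewrite invr_gt0.
  move=> s s_lt; have s1 : rho * mxabs absC s < 1 by rewrite mulrC -ltr_pdivlMr// div1r.
  have [S SP] := W_cvg s s1; exists S; apply: (mx_series_to_le SP).
  by apply: cvg_expr_pow; rewrite // mulr_ge0 ?(ltW rho_gt0) ?mxabs_ge0.
(* [u t] is selected together with its rate of convergence; the default 0 occurs only where no such
   sum exists. *)
pose u t := xget 0 [set S | forall n,
  mxabs absC (\sum_(k < n) W_series q w (g t) k - S) <= (rho * mxabs absC (g t)) ^+ (q ^ n)].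
have O0 : in_O R (0 : laurent F) by rewrite /in_O /laurent_abs eqxx ler01.
have g0 : g 0 = 0.
  by have := g_linear.1 0 0 O0 O0; rewrite addr0 -[LHS]addr0 => /addrI.
(* Continuity at 0, where g vanishes, brings g(t) inside the disc of radius 1/rho. *)
have [|delta delta_gt0 g_small] := g_continuous 0 O0 rho^-1; first by rewrite invr_gt0.
exists u, delta => // t tO t_delta.
have gt_lt t' : in_O R t' -> laurent_abs R t' < delta -> rho * mxabs absC (g t') < 1.
  move=> t'O t'd; have := g_small t' t'O; rewrite subr0 g0 subr0 => /(_ t'd).
  by rewrite mulrC -ltr_pdivlMr// div1r.
have uP t' : in_O R t' -> laurent_abs R t' < delta -> forall n,
    mxabs absC (\sum_(k < n) W_series q w (g t') k - u t') <=
      (rho * mxabs absC (g t')) ^+ (q ^ n).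
  by move=> t'O t'd; exact: (xgetPex 0 (W_cvg _ (gt_lt _ t'O t'd))).
have Xt_delta := le_lt_trans (absX t) t_delta.
have gXt : g (laurentX F * t) = B *m g t.
  have := g_solution t tO; rewrite tau_carlitz_d// /carlitz_delta => /eqP.
  by rewrite subr_eq => /eqP ->; rewrite /B mulmxDl mul_scalar_mx.
have th0 : 0 <= rho * mxabs absC (g t) by rewrite mulr_ge0 ?(ltW rho_gt0) ?mxabs_ge0.
split.
  by apply: (mx_series_to_le (uP t tO t_delta)); apply: cvg_expr_pow => //; exact: gt_lt.
(* The sum of P(tau)u is claimed to be the Carlitz difference itself, so only convergence to it
   remains. *)
exists (u (laurentX F * t) - x *: u t); last by rewrite tau_carlitz_d// subrr.
apply: (series_solves_equation vP q_gt1 w_rec pi_bound qP (ltW x_lt1) th0 _ gXt).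
- exact: gt_lt.
- exact: uP.
(* As |g(xt)| <= |B| |g(t)| <= |g(t)|, the same theta = rho |g(t)| serves at xt. *)
move=> n; apply: le_trans (uP _ (OX _ tO) Xt_delta n) _.
rewrite lerXn2r ?nnegrE ?mulr_ge0 ?mxabs_ge0 ?(ltW rho_gt0)//.
rewrite ler_wpM2l ?(ltW rho_gt0)// gXt -[X in _ <= X]mul1r.
exact: mxabsM_le (ltW B_lt1) (lexx _).
Qed.
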